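(* Let $n\ge2$, let $U\subset\mathbb{R}^n$ be open, and let $\gamma(t;\alpha)$ be a sufficiently big family of smooth regular curves in $U$. Suppose that a symmetric affine connection $\Gamma=\Gamma^a_{bc}$ on $U$ and a function $f:\Omega\to\mathbb{R}$, homogeneous of degree $1$ on each $\Omega_x$, satisfy for every curve $\gamma=\gamma(t;\alpha)$ of the family and all $t$ $$\frac{d^2\gamma^a}{dt^2}+\Gamma^a_{bc}\frac{d\gamma^b}{dt}\frac{d\gamma^c}{dt}=f\!\left(\frac{d\gamma}{dt}\right)\frac{d\gamma^a}{dt}.\qquad( * )$$ Then a pair $(\bar\Gamma,\bar f)$, consisting of a symmetric affine connection on $U$ and a function on $\Omega$ homogeneous of degree $1$ on each $\Omega_x$, also satisfies $( * )$ for all curves of the family if and only if there exists a $1$-form $\phi=\phi_a$ on $U$ such that $$\bar\Gamma^a_{bc}=\Gamma^a_{bc}+\delta^a_b\phi_c+\delta^a_c\phi_b\quad\text{and}\quad \bar f(v)=f(v)+2\phi_bv^b\ \text{ for all } v\in\Omega .$$ That is, the pair $(\Gamma,f)$, if it exists, is uniquely determined by the unparameterized curves up to the freedom $\Gamma^a_{bc}\mapsto\Gamma^a_{bc}+\delta^a_b\phi_c+\delta^a_c\phi_b$, $f\mapsto f+2\phi$.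
   Context: For a family of smooth curves $\gamma(t;\alpha)$ in $U$ (depending on a parameter $\alpha$) and $x_0\in U$ let $\Omega_{x_0}$ be the set of $\xi\in T_{x_0}U$ for which there exist $\alpha$ and $t_0$ such that $\gamma(t_0;\alpha)=x_0$ and $\xi$ is proportional to $\frac{d}{dt}\gamma(t;\alpha)|_{t=t_0}$. The family is sufficiently big if for every $x_0\in U$ the set $\Omega_{x_0}$ contains a nonempty open subset of $T_{x_0}U$. Put $\Omega=\bigcup_{x\in U}\Omega_x\subset TU$. Regular means that velocity vectors do not vanish. ''Homogeneous of degree 1'' means $f(c\,\xi)=c\,f(\xi)$ for $\xi\in\Omega_x$ and constants $c$ with $c\xi\in\Omega_x$; the paper justifies this by allowing linear changes of the parameter of the curves. Equation $( * )$ expresses that the curve is a reparameterized geodesic of $\Gamma$. Connections and $1$-forms are smooth. *)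

(* Defs.v *)
From HB Require Import structures.
From mathcomp Require Import all_boot all_order all_algebra.
From mathcomp Require Import all_classical all_reals all_analysis.
Set Implicit Arguments.
Unset Strict Implicit.
Unset Printing Implicit Defensive.
Import Order.TTheory GRing.Theory Num.Theory.
Import numFieldNormedType.Exports.
Local Open Scope classical_set_scope.
Local Open Scope ring_scope.

(* Objects living on the open set U are total functions on 'rV[R]_n, of which
   only the restriction to U (or, for curves, to their interval) is used. *)

Section Smooth.
Context {R : realType} {n : nat}.

(* [:: i1; ...; ik] stands for d/dx^i1 ... d/dx^ik *)
Definition iter_partial (s : seq 'I_n) (h : 'rV[R]_n -> R) : 'rV[R]_n -> R :=
  foldr (fun i g => 'D_('e_i) g) h s.

(* C^oo on U: partial derivatives of all orders exist and are continuous *)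
Definition smooth_on (U : set 'rV[R]_n) (h : 'rV[R]_n -> R) : Prop :=
  forall (s : seq 'I_n) (x : 'rV[R]_n), U x ->
    {for x, continuous (iter_partial s h)} /\
    forall i : 'I_n, derivable (iter_partial s h) x 'e_i.

Definition smooth_curve (I : set R) (g : R -> 'rV[R]_n) : Prop :=
  forall (k : nat) (t : R), I t -> derivable (derive1n k g) t 1.

End Smooth.

Section Geometry.
Context {R : realType} {n : nat}.
Implicit Types (U : set 'rV[R]_n) (A : Type).

(* The curve with parameter al is g al, defined on the open interval I al. *)
Definition regular_curve_family U A (I : A -> set R)
    (g : A -> R -> 'rV[R]_n) : Prop :=
  forall al : A,
    [/\ I al !=set0, open (I al), is_interval (I al), smooth_curve (I al) (g al)
      & forall t, I al t -> U (g al t) /\ derive1 (g al) t != 0].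

(* Omega I g x is the set $\Omega_x$ of tangent vectors at x; the full $\Omega$
   is the set of pairs (x, xi) with Omega I g x xi. *)
Definition Omega A (I : A -> set R) (g : A -> R -> 'rV[R]_n)
    (x : 'rV[R]_n) : set 'rV[R]_n :=
  [set xi | exists al t0, [/\ I al t0, g al t0 = x
                            & exists c : R, xi = c *: derive1 (g al) t0]].

Definition sufficiently_big U A (I : A -> set R)
    (g : A -> R -> 'rV[R]_n) : Prop :=
  forall x, U x ->
    exists V : set 'rV[R]_n, [/\ open V, V !=set0 & V `<=` Omega I g x].

(* G x a b c is $\Gamma^a_{bc}(x)$. *)
Definition symmetric_connection U
    (G : 'rV[R]_n -> 'I_n -> 'I_n -> 'I_n -> R) : Prop :=
  (forall a b c, smooth_on U (fun x => G x a b c)) /\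
  (forall x, U x -> forall a b c, G x a b c = G x a c b).

Definition one_form U (phi : 'rV[R]_n -> 'I_n -> R) : Prop :=
  forall a, smooth_on U (fun x => phi x a).

(* f x xi is the value of f at the tangent vector xi at x. *)
Definition homogeneous1 U A (I : A -> set R) (g : A -> R -> 'rV[R]_n)
    (f : 'rV[R]_n -> 'rV[R]_n -> R) : Prop :=
  forall x, U x -> forall (c : R) (xi : 'rV[R]_n),
    Omega I g x xi -> Omega I g x (c *: xi) -> f x (c *: xi) = c * f x xi.

Definition reparam_geodesics A (I : A -> set R) (g : A -> R -> 'rV[R]_n)
    (G : 'rV[R]_n -> 'I_n -> 'I_n -> 'I_n -> R)
    (f : 'rV[R]_n -> 'rV[R]_n -> R) : Prop :=
  forall (al : A) (t : R), I al t -> forall a : 'I_n,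
    derive1n 2 (g al) t ord0 a
    + \sum_(b < n) \sum_(c < n)
        G (g al t) a b c * derive1 (g al) t ord0 b * derive1 (g al) t ord0 c
    = f (g al t) (derive1 (g al) t) * derive1 (g al) t ord0 a.

End Geometry.

(* Main.v *)
Require Import Defs.
From HB Require Import structures.
From mathcomp Require Import all_boot all_order all_algebra.
From mathcomp Require Import all_classical all_reals all_analysis.
From mathcomp Require Import ring lra.
Import Order.TTheory GRing.Theory Num.Theory.
Import numFieldNormedType.Exports.
Local Open Scope classical_set_scope.
Local Open Scope ring_scope.

(* Subtracting the two equations ( * ) along the curves, the tensor
   S = G' - G satisfies S(v,v) = (f' - f)(v) v for all v in Omega_x, hence S(v,v)
   is parallel to v on an open set of vectors v.  This is a polynomial condition
   on v, so it holds for every v.  Put phi_c = S^c_cc / 2 and replace S by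
   S - delta phi - delta phi, whose entries S^c_cc vanish: testing on e_b and
   e_b +- e_c shows that it is zero.  Then f' - f = 2 phi on the nonzero vectors
   of Omega, and on the zero vector both sides vanish by homogeneity. *)

(** * Linear combinations of smooth functions *)

Section SmoothFunctions.
Context {R : realType} {n : nat}.
Implicit Types (U : set 'rV[R]_n) (h k : 'rV[R]_n -> R).

Lemma iter_partial_lincomb U (p q : R) h k (s : seq 'I_n) (x : 'rV[R]_n) :
  open U -> smooth_on U h -> smooth_on U k -> U x ->
  iter_partial s (fun y => p * h y + q * k y) x
    = p * iter_partial s h x + q * iter_partial s k x.
Proof.
move=> oU sh sk; elim: s x => [//|i s IH] x Ux /=.
(* The induction hypothesis holds only at points of [U]; since [U] is open it holds near [x], which
   is what differentiating both sides at [x] requires. *)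
have nU : \forall y \near x, iter_partial s (fun y => p * h y + q * k y) y
    = (p *: iter_partial s h + q *: iter_partial s k) y.
  by near=> y; apply: IH; near: y; exact: open_nbhs_nbhs.
rewrite (near_eq_derive _ nU).
have dh := (sh s x Ux).2 i; have dk := (sk s x Ux).2 i.
by rewrite deriveD ?deriveZ//; exact: derivableZ.
Unshelve. all: by end_near. Qed.

Lemma smooth_on_lincomb U (p q : R) h k :
  open U -> smooth_on U h -> smooth_on U k ->
  smooth_on U (fun x => p * h x + q * k x).
Proof.
move=> oU sh sk s x Ux.
have nU : \forall y \near x, (p *: iter_partial s h + q *: iter_partial s k) y
    = iter_partial s (fun y => p * h y + q * k y) y.
  near=> y; apply/esym; apply: (iter_partial_lincomb U) => //.
  by near: y; exact: open_nbhs_nbhs.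
have [ch dh] := sh s x Ux; have [ck dk] := sk s x Ux.
split=> [|i]; last first.
  apply: (near_eq_derivable nU).
  by apply: derivableD; apply: derivableZ.
rewrite /prop_for /continuous_at/= (iter_partial_lincomb U)//.
apply: cvg_trans; first exact: (near_eq_cvg nU).
by apply: cvgD; apply: cvgZ => //; exact: cvg_cst.
Unshelve. all: by end_near. Qed.

End SmoothFunctions.

(** * Symmetric tensors S with S(v,v) parallel to v *)

Section Tensors.
Context {R : realType} {n : nat}.
Implicit Types (S T : 'I_n -> 'I_n -> 'I_n -> R) (v w : 'rV[R]_n).

Definition contract2 S v w (a : 'I_n) : R :=
  \sum_(b < n) \sum_(c < n) S a b c * v ord0 b * w ord0 c.

Lemma contract2_delta S a b c :
  contract2 S (delta_mx ord0 b) (delta_mx ord0 c) a = S a b c.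
Proof.
rewrite /contract2 (bigD1 b)//= (bigD1 c)//= !mxE !eqxx !mulr1.
rewrite big1 ?addr0 => [|c' /negbTE cc]; last by rewrite !mxE cc mulr0.
rewrite big1 ?addr0// => b' /negbTE bb.
by rewrite big1// => c' _; rewrite !mxE bb mulr0 mul0r.
Qed.

Lemma contract2_sym S v w a : (forall b c, S a b c = S a c b) ->
  contract2 S v w a = contract2 S w v a.
Proof.
move=> symS; rewrite /contract2 exchange_big/=.
by apply: eq_bigr => b _; apply: eq_bigr => c _; rewrite symS; ring.
Qed.

Lemma contract2_line S v w (t : R) a : (forall b c, S a b c = S a c b) ->
  contract2 S (v + t *: w) (v + t *: w) a
  = contract2 S v v a + 2 * t * contract2 S v w a
    + t ^+ 2 * contract2 S w w a.
Proof.
move=> symS.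
have -> : 2 * t * contract2 S v w a
    = t * contract2 S v w a + t * contract2 S w v a.
  by rewrite (contract2_sym S w v)//; ring.
rewrite /contract2 !mulr_sumr -!big_split/=; apply: eq_bigr => b _.
rewrite !mulr_sumr -!big_split/=; apply: eq_bigr => c _.
by rewrite !mxE; ring.
Qed.

Definition radial S v := exists l : R, forall a, contract2 S v v a = l * v ord0 a.

(** The third finite difference with step [h] kills all terms of degree at most 2 and sends the
    cubic term to 6 h^3 [c3]. Only the four nodes 0, h, 2h, 3h enter, so a cubic has to be
    controlled on a short segment only. *)
Lemma cubic_lead_eq0 (c0 c1 c2 c3 h : R) : h != 0 ->
  (forall k : 'I_4, c0 + c1 * (k%:R * h) + c2 * (k%:R * h) ^+ 2
                    + c3 * (k%:R * h) ^+ 3 = 0) ->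
  c3 = 0.
Proof.
move=> h0 H.
pose q (t : R) := c0 + c1 * t + c2 * t ^+ 2 + c3 * t ^+ 3.
have q0 (k : nat) : (k < 4)%N -> q (k%:R * h) = 0.
  by move=> k4; exact: (H (Ordinal k4)).
have : 6 * h ^+ 3 * c3
    = q (3%:R * h) - 3 * q (2%:R * h) + 3 * q (1%:R * h) - q (0%:R * h).
  by rewrite /q; ring.
rewrite !q0// !mulr0 !subr0 addr0.
move/eqP; rewrite mulf_eq0 => /orP[|/eqP//].
by rewrite mulf_eq0 expf_eq0/= (negbTE h0) pnatr_eq0.
Qed.

(* On a line v + t w the minors of the pair (S(u,u), u) are cubic polynomials
   in t whose leading coefficients are the corresponding minors at w. *)
Lemma radial_open_minor S (V : set 'rV[R]_n) w (a d : 'I_n) :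
  (forall a b c, S a b c = S a c b) -> open V -> V !=set0 ->
  (forall v, V v -> radial S v) ->
  contract2 S w w a * w ord0 d = contract2 S w w d * w ord0 a.
Proof.
move=> symS oV [v Vv] radV.
have nV : \forall t \near (0 : R), V (v + t *: w).
  have cl : {for (0 : R), continuous (fun t : R => v + t *: w)}.
    by apply: cvgD; [|apply: cvgZ => //]; exact: cvg_cst.
  by apply: cl; rewrite scale0r addr0; exact: open_nbhs_nbhs.
have [e /= e0 He] := nV.
apply/eqP; rewrite -subr_eq0; apply/eqP.
pose m x y := contract2 S x y a; pose m' x y := contract2 S x y d.
(* The first three arguments are the coefficients of 1, t, t^2 in the minor at v + t w; the fourth
   is read off from the goal. The step [e / 4] keeps the nodes k e/4, k < 4, at distance less than
   [e] from 0, so that v + t w stays in [V]. *)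
apply: (cubic_lead_eq0 (m v v * v ord0 d - m' v v * v ord0 a)
  (2 * m v w * v ord0 d + m v v * w ord0 d
    - 2 * m' v w * v ord0 a - m' v v * w ord0 a)
  (m w w * v ord0 d + 2 * m v w * w ord0 d
    - m' w w * v ord0 a - 2 * m' v w * w ord0 a) _ (e / 4)).
  by rewrite gt_eqF// divr_gt0.
move=> k; set t := k%:R * (e / 4).
have /radV[l Hl] : V (v + t *: w).
  apply: He; rewrite /ball/= sub0r normrN ger0_norm; last first.
    by rewrite mulr_ge0// divr_ge0// ltW.
  have : (k%:R : R) < 4 by rewrite (ltr_nat R _ 4).
  by rewrite /t; nra.
have Ha := Hl a; have Hd := Hl d.
rewrite !contract2_line// !mxE -/(m _ _) -/(m' _ _) in Ha Hd.
rewrite -/(m _ _) -/(m' _ _).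
transitivity ((m v v + 2 * t * m v w + t ^+ 2 * m w w) * (v ord0 d + t * w ord0 d)
  - (m' v v + 2 * t * m' v w + t ^+ 2 * m' w w) * (v ord0 a + t * w ord0 a)).
  by ring.
by rewrite Ha Hd; ring.
Qed.

Lemma radial_open_eq0 S (V : set 'rV[R]_n) :
  (forall a b c, S a b c = S a c b) -> (forall c, S c c c = 0) ->
  open V -> V !=set0 -> (forall v, V v -> radial S v) ->
  forall a b c, S a b c = 0.
Proof.
move=> symS diagS oV V0 radV.
have minor w a d := radial_open_minor S V w a d symS oV V0 radV.
have S_abb a b : S a b b = 0.
  have [->//|ab] := eqVneq a b.
  (* At e_b the minor of rows a and b reads S^a_bb = 0, because the entry a of e_b is zero. *)
  have := minor (delta_mx ord0 b) a b.
  by rewrite !contract2_delta !mxE !eqxx/= (negbTE ab) mulr1 mulr0.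
move=> a b c; have [->//|bc] := eqVneq b c.
have eval (t : R) d : contract2 S (delta_mx ord0 b + t *: delta_mx ord0 c)
    (delta_mx ord0 b + t *: delta_mx ord0 c) d = 2 * t * S d b c.
  by rewrite contract2_line// !contract2_delta !S_abb mulr0 addr0 add0r.
have entry (t : R) d : (delta_mx ord0 b + t *: delta_mx ord0 c : 'rV[R]_n) ord0 d
    = (d == b)%:R + t * (d == c)%:R by rewrite !mxE.
have cb : (c == b) = false by rewrite eq_sym (negbTE bc).
(* For u = e_b + t e_c the minor of rows b and c reads 2 t^2 S^b_bc = 2 t S^c_bc. Taking t = 1 and t
   = -1 makes the two entries both equal and opposite, hence zero. *)
have Sb : S b b c = 0 /\ S c b c = 0.
  have := minor (delta_mx ord0 b + 1 *: delta_mx ord0 c) b c.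
  have := minor (delta_mx ord0 b + (-1) *: delta_mx ord0 c) b c.
  rewrite !eval !entry !eqxx (negbTE bc) cb /=; lra.
have [->|ab] := eqVneq a b; first by case: Sb.
(* In the minor of rows a and b at e_b + e_c the right side contains the factor S^b_bc = 0, whether
   or not a equals c. *)
have := minor (delta_mx ord0 b + 1 *: delta_mx ord0 c) a b.
rewrite !eval !entry !eqxx (negbTE bc) (negbTE ab) /=; case: Sb => -> _; lra.
Qed.

End Tensors.

Lemma mulr_entry_inj (R : realType) (n : nat) (v : 'rV[R]_n) (l m : R) :
  v != 0 -> (forall a, l * v ord0 a = m * v ord0 a) -> l = m.
Proof.
move=> v0 lm; apply/eqP; have /rV0Pn[a va] := v0.
by apply/eqP; exact: (mulIf va).
Qed.

(** * The projective change of a connection *)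

Section Projective.
Context {R : realType} {n : nat}.
Implicit Types (S T : 'I_n -> 'I_n -> 'I_n -> R) (p : 'I_n -> R).

Definition projective_tensor p (a b c : 'I_n) : R :=
  (a == b)%:R * p c + (a == c)%:R * p b.

Lemma contract2_projective p (v : 'rV[R]_n) a :
  contract2 (projective_tensor p) v v a
  = 2 * (\sum_(b < n) p b * v ord0 b) * v ord0 a.
Proof.
have E : \sum_(b < n) \sum_(c < n) (a == b)%:R * p c * v ord0 b * v ord0 c
    = (\sum_(b < n) p b * v ord0 b) * v ord0 a.
  rewrite (bigD1 a)//= eqxx [X in _ + X]big1 ?addr0 => [|b ba].
    by rewrite mulr_suml; apply: eq_bigr => c _; rewrite mulr1n mul1r mulrAC.
  by rewrite big1// => c _; rewrite eq_sym (negbTE ba) !mul0r.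
(* The factor 2 is split into two copies of [E]; exchanging the sums in the second one turns it into
   the contraction of the other delta term. *)
rewrite -mulrA mulr2n mulrDl mul1r -{1}E -E [X in _ + X]exchange_big/=.
rewrite /contract2 -big_split/=; apply: eq_bigr => b _.
rewrite -big_split/=; apply: eq_bigr => c _.
by rewrite /projective_tensor; ring.
Qed.

Lemma contract2D S T (v w : 'rV[R]_n) a :
  contract2 (fun a b c => S a b c + T a b c) v w a
  = contract2 S v w a + contract2 T v w a.
Proof.
rewrite /contract2 -big_split/=; apply: eq_bigr => b _.
by rewrite -big_split/=; apply: eq_bigr => c _; ring.
Qed.

Lemma contract2B S T (v w : 'rV[R]_n) a :
  contract2 (fun a b c => S a b c - T a b c) v w a
  = contract2 S v w a - contract2 T v w a.
Proof.
apply/eqP; rewrite eq_sym subr_eq -contract2D; apply/eqP.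
by congr (contract2 _ _ _ _); do 3!apply: funext => ?; rewrite subrK.
Qed.

Lemma contract2Z S (k l : R) (v w : 'rV[R]_n) a :
  contract2 S (k *: v) (l *: w) a = k * l * contract2 S v w a.
Proof.
rewrite /contract2 mulr_sumr; apply: eq_bigr => b _.
by rewrite mulr_sumr; apply: eq_bigr => c _; rewrite !mxE; ring.
Qed.

(** The diagonal entry (c,c,c) of [projective_tensor p] is 2 [p c], whence the factor 1/2.
    Subtracting this tensor only shifts the factor l in S(v,v) = l v, so the difference is still
    radial, now with zero diagonal entries. *)
Lemma radial_open_projective S (V : set 'rV[R]_n) :
  (forall a b c, S a b c = S a c b) ->
  open V -> V !=set0 -> (forall v, V v -> radial S v) ->
  S = projective_tensor (fun c => 2^-1 * S c c c).
Proof.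
move=> symS oV V0 radV; set p := fun c => _.
do 3!apply: funext => ?; apply/eqP; rewrite -subr_eq0; apply/eqP.
apply: (radial_open_eq0 (fun a b c => S a b c - projective_tensor p a b c) V)
  => //.
- by move=> a b c; rewrite symS /projective_tensor; ring.
- by move=> c; rewrite /projective_tensor /p eqxx /=; field.
- move=> v /radV[l Hl]; exists (l - 2 * \sum_(b < n) p b * v ord0 b) => a.
  by rewrite contract2B Hl contract2_projective; ring.
Qed.

End Projective.

(** * From pointwise algebra to families of curves *)

Section Geodesics.
Context {R : realType} {n : nat}.

(** The proportionality factor in [Omega] may be 0, so Omega_x can contain the zero vector, where an
    equation between multiples of v does not determine f; homogeneity with constant 0 does. *)
Lemma homogeneous1_0 (U : set 'rV[R]_n) (A : Type) (I : A -> set R)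
    (g : A -> R -> 'rV[R]_n) (f : 'rV[R]_n -> 'rV[R]_n -> R) (x : 'rV[R]_n) :
  homogeneous1 U I g f -> U x -> Omega I g x 0 -> f x 0 = 0.
Proof.
move=> hom Ux O0; rewrite -[X in f x X](scale0r (0 : 'rV[R]_n)) hom//.
  by rewrite mul0r.
by rewrite scale0r.
Qed.

Lemma Omega_velocity (A : Type) (I : A -> set R) (g : A -> R -> 'rV[R]_n)
    (al : A) (t : R) :
  I al t -> Omega I g (g al t) (derive1 (g al) t).
Proof. by move=> It; exists al, t; split=> //; exists 1; rewrite scale1r. Qed.

End Geodesics.

Theorem mainTheorem3 (R : realType) (n : nat) (n_ge2 : (2 <= n)%N)
  (U : set 'rV[R]_n) (openU : open U)
  (A : Type) (I : A -> set R) (g : A -> R -> 'rV[R]_n)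
  (g_family : regular_curve_family U I g)
  (g_big : sufficiently_big U I g)
  (G : 'rV[R]_n -> 'I_n -> 'I_n -> 'I_n -> R)
  (f : 'rV[R]_n -> 'rV[R]_n -> R)
  (G_conn : symmetric_connection U G)
  (f_hom : homogeneous1 U I g f)
  (Gf_geod : reparam_geodesics I g G f)
  (G' : 'rV[R]_n -> 'I_n -> 'I_n -> 'I_n -> R)
  (f' : 'rV[R]_n -> 'rV[R]_n -> R)
  (G'_conn : symmetric_connection U G')
  (f'_hom : homogeneous1 U I g f') :
  reparam_geodesics I g G' f' <->
  exists phi : 'rV[R]_n -> 'I_n -> R,
    [/\ one_form U phi,
        (forall x, U x -> forall a b c : 'I_n,
           G' x a b c = G x a b c + (a == b)%:R * phi x c
                                  + (a == c)%:R * phi x b)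
      & (forall x, U x -> forall v, Omega I g x v ->
           f' x v = f x v + 2 * \sum_(b < n) phi x b * v ord0 b)].
Proof.
split=> [G'f'_geod|[phi [_ G'E f'E]]]; last first.
  move=> al t It a.
  have [_ _ _ _ /(_ t It)[Ux _]] := g_family al.
  have Om := Omega_velocity A I g al t It.
  (* The extra terms agree: contracting the projective tensor twice with the velocity v gives 2
     phi(v) v. *)
  rewrite f'E// mulrDl -(Gf_geod _ _ It) -addrA; congr (_ + _).
  rewrite -contract2_projective -contract2D /contract2.
  apply: eq_bigr => b _; apply: eq_bigr => c _.
  by rewrite G'E// /projective_tensor addrA.
pose D x a b c := G' x a b c - G x a b c.
pose phi x c := 2^-1 * D x c c c.
have D_Omega x v : U x -> Omega I g x v ->
    forall a, contract2 (D x) v v a = (f' x v - f x v) * v ord0 a.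
  move=> Ux Ov a; case: (Ov) => al [t [It gx [c vE]]].
  have Om : Omega I g x (derive1 (g al) t).
    by rewrite -gx; exact: Omega_velocity.
  move: Ov; rewrite vE => Ov.
  (* A vector of Omega is only a multiple c of a velocity; both sides scale by c^2, the right one by
     homogeneity. For the velocity itself the accelerations cancel when the two geodesic equations
     are subtracted. *)
  rewrite f_hom// f'_hom// contract2Z contract2B !mxE.
  have := Gf_geod _ _ It a; have := G'f'_geod _ _ It a.
  rewrite gx -!/(contract2 _ _ _ _) => e' e.
  have {}e : contract2 (G x) (derive1 (g al) t) (derive1 (g al) t) a
     = f x (derive1 (g al) t) * derive1 (g al) t ord0 a - derive1n 2 (g al) t ord0 a.
    by rewrite -e addrC addKr.
  have {}e' : contract2 (G' x) (derive1 (g al) t) (derive1 (g al) t) a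
     = f' x (derive1 (g al) t) * derive1 (g al) t ord0 a - derive1n 2 (g al) t ord0 a.
    by rewrite -e' addrC addKr.
  by rewrite e e'; ring.
have D_proj x : U x -> D x = projective_tensor (phi x).
  move=> Ux; have [V [oV V0 VO]] := g_big x Ux.
  apply: (radial_open_projective _ V) => //.
    by move=> a b c; rewrite /D G_conn.2// G'_conn.2.
  by move=> v /VO Ov; exists (f' x v - f x v); exact: D_Omega.
exists phi; split.
- move=> c.
  (* Smoothness of [phi] comes from its formula in terms of the connections, with no regularity of f
     or f' involved. *)
  have -> : phi^~ c = fun x => 2^-1 * G' x c c c + (- 2^-1) * G x c c c.
    by apply: funext => x; rewrite /phi /D; ring.
  by apply: smooth_on_lincomb => //; [exact: G'_conn.1|exact: G_conn.1].
- move=> x Ux a b c; rewrite -addrA -/(projective_tensor (phi x) a b c).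
  by rewrite -D_proj// /D addrC subrK.
- move=> x Ux v Ov; apply/eqP; rewrite addrC -subr_eq; apply/eqP.
  (* For v nonzero, (f' - f)(v) v = 2 phi(v) v can be cancelled by v. *)
  have [v0|v0] := eqVneq v 0.
    rewrite v0 in Ov *.
    rewrite (homogeneous1_0 U A I g f')// (homogeneous1_0 U A I g f)// subr0.
    by rewrite big1 ?mulr0// => b _; rewrite mxE mulr0.
  apply: (mulr_entry_inj _ _ v) => // a.
  by rewrite -contract2_projective -D_proj// D_Omega.
Qed.
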